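(* Let $G$ be a torsion group. For every infinite cardinal $\alpha\geqslant |G|$, there exists a torsion group $H_\alpha$ of cardinality $\alpha$ which has the $R_\infty$ property and contains an isomorphic copy of $G$ (as a subgroup).
   Context: A group is torsion if every element has finite order. For a group $H$ and $\phi\in\mathrm{Aut}(H)$ (maps written on the right), elements $a,b\in H$ are $\phi$-twisted conjugate if there is $x\in H$ with $(x^{-1})\phi\, a x=b$; the Reidemeister number $R(\phi)$ is the number of $\phi$-twisted conjugacy classes in $H$. $H$ has the $R_\infty$ property if $R(\phi)=\infty$ (infinitely many classes) for every $\phi\in\mathrm{Aut}(H)$. *)

(* Defs.v *)
From HB Require Import structures.
From mathcomp Require Import all_boot.
From mathcomp Require Import boolp classical_sets functions cardinality.

Set Implicit Arguments.
Unset Strict Implicit.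
Unset Printing Implicit Defensive.

Local Open Scope classical_set_scope.
Local Open Scope group_scope.

Definition torsion_group (G : groupType) : Prop :=
  forall x : G, exists2 n : nat, (0 < n)%N & x ^+ n = 1.

(* With maps written on the right this reads (x^-1)phi a x = b. *)
Definition twisted_conjugate (H : groupType) (phi : H -> H) (a b : H) : Prop :=
  exists x : H, phi x^-1 * a * x = b.

Definition twisted_class (H : groupType) (phi : H -> H) (a : H) : set H :=
  [set b | twisted_conjugate phi a b].

(* The Reidemeister number of phi is the cardinal of this set. *)
Definition twisted_classes (H : groupType) (phi : H -> H) : set (set H) :=
  range (twisted_class phi).

Definition R_infinity (H : groupType) : Prop :=
  forall phi : {multiplicative H -> H},
    bijective phi -> infinite_set (twisted_classes phi).

(* Some subgroup K of H is isomorphic to G. *)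
Definition contains_copy (H G : groupType) : Prop :=
  exists2 K : {pred H}, group_closed K &
    exists f : {multiplicative G -> H}, set_bij [set: G] [set` K] f.

(* Main.v *)
From HB Require Import structures.
Require Import Defs.
From mathcomp Require Import all_boot all_algebra ring.
From mathcomp Require Import boolp classical_sets functions cardinality.

(** The group is the restricted wreath product of [L] by [Q], where [Q] is the
    restricted direct sum of the dihedral groups of order [2 p] over all odd
    primes [p], and [L] is the restricted direct sum of [G] and of copies of the
    dihedral group of order six indexed by [A]. It is torsion and contains [G].
    Its elements are encoded by finite words over [A], so its cardinality is
    that of [A] by Hessenberg's theorem ([infinite_square], [infinite_seq]).

    The invariants that separate twisted classes are the signs: for every odd
    prime [p], an element of the wreath product acts on the [p]-rotations of [Q]
    by the identity or by inversion. Each sign is a homomorphism to a group of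
    order two, and there are infinitely many independent ones. If all of them
    are invariant under an automorphism [phi], then they are constant on
    [phi]-twisted classes, which are therefore infinitely many
    ([infinite_twisted_classes]).

    Invariance rests on two facts. First, [phi] or its inverse maps the base
    group, the kernel of the projection to [Q], into itself
    ([preserves_base_or]). Indeed an element concentrated at one coordinate of
    the base commutes with all its conjugates by elements outside the base,
    whereas an element outside the base fails to commute with its conjugate by
    any one-coordinate element whose square is not trivial; and [L] is built so
    that such elements generate it. Secondly, an automorphism that maps the base
    into itself induces a surjective endomorphism of [Q], and the orders of
    elements force this endomorphism to send some [p]-rotation to a nontrivial
    [p]-rotation; equivariance then gives invariance of the sign at [p]
    ([sign_preserved]). *)

Set Implicit Arguments.
Unset Strict Implicit.
Unset Printing Implicit Defensive.

Import GRing.Theory.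

Local Open Scope classical_set_scope.
Local Open Scope card_scope.

(** * Squares and words over an infinite set *)

Definition embeds (T U : Type) := exists f : T -> U, injective f.

Lemma embeds_trans T U V : embeds T U -> embeds U V -> embeds T V.
Proof. by move=> [f fI] [g gI]; exists (g \o f); apply: inj_comp. Qed.

Lemma embeds_prod T T' U U' :
  embeds T T' -> embeds U U' -> embeds (T * U) (T' * U').
Proof.
move=> [f fI] [g gI]; exists (fun p => (f p.1, g p.2)).
by move=> [a b] [c d] [/fI -> /gI ->].
Qed.

Lemma sval_inj T (P : T -> Prop) : injective (@sval T P).
Proof. by move=> [x Px] [y Py] /= xy; apply: eq_exist. Qed.

Lemma card_le_embeds T U : [set: T] #<= [set: U] <-> embeds T U.
Proof.
split=> [/card_leP[f]|[f fI]].
  exists (fun t => val (f (SigSub (mem_setT t)))) => x y /val_inj.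
  by move=> /(@inj _ _ _ f _ _ (in_setT _) (in_setT _)) [].
suff [g] : $|{injfun [set: T] >-> [set: U]}| by exact: inj_card_le.
by apply/injfunPex; exists f => // x y _ _ /fI.
Qed.

(** The graph of an injection from a part of [T] to [U]. The condition is
    symmetric in the two sides and passes to unions of chains, which is what
    Zorn's lemma asks for. *)
Definition partial_injection T U (E : set (T * U)) :=
  forall p q, E p -> E q -> p.1 = q.1 <-> p.2 = q.2.

Lemma partial_injection_bigcup T U (C : set (set (T * U))) :
  (forall E, C E -> partial_injection E) -> total_on C subset ->
  partial_injection (\bigcup_(E in C) E).
Proof.
move=> CE Ctot p q [E CE1 Ep] [F CF Fq].
by have [EF|FE] := Ctot _ _ CE1 CF; [apply: (CE _ CF)|apply: (CE _ CE1)]; auto.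
Qed.

(** A maximal partial injection is defined everywhere or hits everything:
    otherwise one more pair could be added. *)
Lemma embeds_total T U : embeds T U \/ embeds U T.
Proof.
have [F CF Ftot|E [EI Emax]] := @Zorn_bigcup _ (@partial_injection T U).
  exact: partial_injection_bigcup.
have [domE|/existsNP[t tE]] := pselect (forall t, exists u, E (t, u)).
  left; exists (fun t => sval (cid (domE t))) => a b /=.
  by case: cid => x Ex; case: cid => y Ey /= xy; exact/(EI _ _ Ex Ey).
have [codE|/existsNP[u uE]] := pselect (forall u, exists t, E (t, u)).
  right; exists (fun u => sval (cid (codE u))) => a b /=.
  by case: cid => x Ex; case: cid => y Ey /= xy; exact/(EI _ _ Ex Ey).
have EU : E `<` E `|` [set (t, u)].
  split; first exact: subsetUl.
  by move=> /(_ (t, u)) H; apply: tE; exists u; apply: H; right.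
case: (Emax _ EU) => -[a b] [c d] /= [Eab|[-> ->]] [Ecd|[-> ->]] //=.
- exact: EI Eab Ecd.
- by split=> H; [case: tE; exists b|case: uE; exists a]; rewrite -H.
- by split=> H; [case: tE; exists d|case: uE; exists c]; rewrite H.
Qed.

Section Square.
Variable A : Type.
Implicit Types E : set (A * A * A).

(** [E] is meant as the graph of an injection [X * X -> X] for some part [X]
    of [A]; [X] is then recovered from the diagonal. *)
Definition diagonal E : set A := [set a | exists c, E (a, a, c)].

Definition squaring E := [/\ partial_injection E,
  forall a b c, E (a, b, c) -> [/\ diagonal E a, diagonal E b & diagonal E c] &
  forall a b, diagonal E a -> diagonal E b -> exists c, E (a, b, c)].

Lemma squaring_bigcup (C : set (set (A * A * A))) :
  C `<=` squaring -> total_on C subset -> squaring (\bigcup_(E in C) E).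
Proof.
move=> CS Ctot; split.
- by apply: partial_injection_bigcup => // E /CS[].
- move=> a b c [E CE Eabc].
  have [_ /(_ _ _ _ Eabc)[] [x Ex] [y Ey] [z Ez] _] := CS _ CE.
  by split; [exists x|exists y|exists z]; exists E.
- move=> a b [x [E CE Ex]] [y [F CF Fy]].
  have [EF|FE] := Ctot _ _ CE CF.
    have [_ _ S] := CS _ CF.
    by have [||c] := S a b; [exists x; auto|exists y; auto|exists c; exists F].
  have [_ _ S] := CS _ CE.
  by have [||c] := S a b; [exists x; auto|exists y; auto|exists c; exists E].
Qed.

Definition nat_squaring (i : nat -> A) : set (A * A * A) :=
  [set (i m, i n, i (pickle (m, n))) | m in [set: nat] & n in [set: nat]].

Lemma squaring_nat i : injective i -> squaring (nat_squaring i).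
Proof.
move=> iI; have D n : diagonal (nat_squaring i) (i n).
  by exists (i (pickle (n, n))); exists n => //; exists n.
split.
- move=> _ _ [m _ [n _ <-]] [m' _ [n' _ <-]] /=; split.
    by move=> [/iI -> /iI ->].
  by move=> /iI/(pcan_inj pickleK)[-> ->].
- by move=> a b c [m _ [n _ [<- <- <-]]]; split.
- move=> _ _ [_ [m _ [m' _ [<- _ _]]]] [_ [n _ [n' _ [<- _ _]]]].
  by exists (i (pickle (m, n))); exists m => //; exists n.
Qed.

(** Zorn's lemma needs the empty relation as union of the empty chain, but a
    maximal relation is useful only if it lives on an infinite part of [A].
    So the chain condition is applied to the relations that are empty or extend
    a fixed one on a countable part. *)
Lemma maximal_squaring (i : nat -> A) : injective i ->
  exists E, [/\ squaring E, nat_squaring i `<=` E &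
    forall F, E `<` F -> ~ squaring F].
Proof.
move=> iI; pose P E := squaring E /\ (E = set0 \/ nat_squaring i `<=` E).
have iN : nat_squaring i (i 0, i 0, i (pickle (0, 0))).
  by exists 0 => //; exists 0.
have [C CP Ctot|E [[SE E0] Emax]] := @Zorn_bigcup _ P.
  split; first by apply: squaring_bigcup => // E /CP[].
  have [C0|/existsNP[E]] := pselect (forall E, C E -> E = set0).
    by left; apply/seteqP; split=> // p [E /C0 -> []].
  move=> /not_implyP[CE E0]; right => p ip; exists E => //.
  by have [_ []] := CP _ CE; [|apply].
have {E0}iE : nat_squaring i `<=` E.
  case: E0 => // E0; case: (Emax (nat_squaring i)).
    by rewrite E0; split=> // /(_ _ iN).
  by split; [exact: squaring_nat | right].
exists E; split=> // F EF SF; apply: (Emax F EF); split=> //; right.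
by apply: subset_trans iE _; case: EF.
Qed.

(** Hessenberg's theorem. Let [X * X -> X] be a maximal injection. If the
    complement of [X] embeds in [X], then so does [A], and the injection
    transfers to [A]. Otherwise the complement contains a copy [Y] of [X], and
    the new pairs of the square of [X] union [Y] can be sent injectively
    into [Y], against maximality. *)
Lemma infinite_square : infinite_set [set: A] -> embeds (A * A) A.
Proof.
move=> /infiniteP/card_le_embeds[i iI].
have [E [[EI ED ES] iE Emax]] := maximal_squaring iI.
pose X := {a | diagonal E a}.
have iX n : diagonal E (i n).
  by exists (i (pickle (n, n))); apply: iE; exists n => //; exists n.
pose x0 : X := exist _ _ (iX 0); pose x1 : X := exist _ _ (iX 1).
have x01 : x0 <> x1 by move=> [/iI].
have [f fI] : embeds (X * X) X.
  have H (p : X * X) : exists c : X, E (sval p.1, sval p.2, sval c).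
    have [c Ec] := ES _ _ (svalP p.1) (svalP p.2).
    by have [_ _ Dc] := ED _ _ _ Ec; exists (exist _ c Dc).
  exists (fun p => sval (cid (H p))) => -[a b] [c d] /=.
  case: cid => x /= Ex; case: cid => y /= Ey xy.
  have /(EI _ _ Ex Ey)/= [] : sval x = sval y by rewrite xy.
  by move=> /sval_inj -> /sval_inj ->.
have [[j jI]|[k kI]] := embeds_total X {a | ~ diagonal E a}; last first.
  suff [g gI] : embeds A X.
    apply: embeds_trans (embeds_prod (ex_intro _ g gI) (ex_intro _ g gI)) _.
    by apply: (@embeds_trans _ X); [exists f|exists sval; exact: sval_inj].
  pose g a := match pselect (diagonal E a) with
    | left Da => f (x0, exist _ a Da)
    | right Da => f (x1, k (exist _ a Da)) end.
  exists g => a b; rewrite /g; case: pselect => Da; case: pselect => Db /fI.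
  - by move=> [].
  - by move=> [/iI].
  - by move=> [/iI].
  - by move=> [/kI []].
pose Y a := exists x, sval (j x) = a; pose Z a := diagonal E a \/ Y a.
have YD a : Y a -> ~ diagonal E a by move=> [x <-]; apply: svalP (j x).
(* h embeds the union of X and Y in X: the square of X holds the two disjoint
   copies [x0] * X and [x1] * X of X. *)
pose h a := match pselect (diagonal E a), pselect (Y a) with
  | left Da, _ => f (x0, exist _ a Da)
  | _, left Ya => f (x1, sval (cid Ya))
  | _, _ => x0 end.
have hI a b : Z a -> Z b -> h a = h b -> a = b.
  rewrite /h => Za Zb.
  case: pselect => Da; last case: pselect => [Ya|Ya]; last by case: Za.
    case: pselect => Db; last case: pselect => [Yb|Yb]; last by case: Zb.
      by move=> /fI [].
    by move=> /fI [/iI].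
  case: pselect => Db; last case: pselect => [Yb|Yb]; last by case: Zb.
    by move=> /fI [/iI].
  by move=> /fI [] e; rewrite -(svalP (cid Ya)) -(svalP (cid Yb)) e.
pose new : set (A * A * A) := [set p | [/\ Z p.1.1, Z p.1.2,
  ~ (diagonal E p.1.1 /\ diagonal E p.1.2) &
  p.2 = sval (j (f (h p.1.1, h p.1.2)))]].
have newY a b c : new (a, b, c) -> Y c.
  by move=> [_ _ _ /= ->]; exists (f (h a, h b)).
have DF a : diagonal (E `|` new) a <-> Z a.
  split=> [[c [Ec|[]//]]|Za]; first by left; exists c.
  have [Da|Da] := pselect (diagonal E a).
    by have [c Ec] := Da; exists c; left.
  by exists (sval (j (f (h a, h a)))); right; split=> // -[].
have EF : E `<` E `|` new.
  split; first exact: subsetUl.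
  have Yj : Y (sval (j x0)) by exists x0.
  have /DF[c jc] : Z (sval (j x0)) by right.
  by move=> /(_ _ jc) Ec; apply: (YD _ Yj); exists c.
case: (Emax _ EF); split.
- have cross a b c a' b' c' : E (a, b, c) -> new (a', b', c') ->
      (a, b) = (a', b') <-> c = c'.
    move=> Ec nc; have [Da Db Dc] := ED _ _ _ Ec; split=> [[ea eb]|ec].
      by case: nc => _ _ /= []; rewrite -ea -eb.
    by case: (YD _ (newY _ _ _ nc)); rewrite -ec.
  move=> [[a b] c] [[a' b'] c'] [Ep|np] [Eq|nq] /=.
  + exact: EI Ep Eq.
  + exact: cross.
  + by have [H1 H2] := cross _ _ _ _ _ _ Eq np; split=> [/esym/H1|/esym/H2].
  + case: np nq => /= Za Zb _ -> [/= Za' Zb' _ ->]; split=> [[-> ->] //|].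
    by move=> /sval_inj/jI/fI[/hI -> // /hI ->].
- move=> a b c [Ec|nc].
    by have [Da Db Dc] := ED _ _ _ Ec; split; apply/DF; left.
  have [/= Za Zb _ _] := nc.
  by split; apply/DF => //; right; apply: newY nc.
- move=> a b /DF Za /DF Zb.
  have [[Da Db]|nD] := pselect (diagonal E a /\ diagonal E b).
    by have [c Ec] := ES _ _ Da Db; exists c; left.
  by exists (sval (j (f (h a, h b)))); right.
Qed.

Lemma infinite_embeds_nat : infinite_set [set: A] -> embeds nat A.
Proof. by move=> /infiniteP/card_le_embeds. Qed.

(** A word is determined by its length and an iterated pairing of its letters;
    the length is needed because the code of the empty word may also be a
    value of the pairing. *)
Lemma infinite_seq : infinite_set [set: A] -> embeds (seq A) A.
Proof.
move=> Ainf; have [p pI] := infinite_square Ainf.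
have [i iI] := infinite_embeds_nat Ainf.
pose code := foldr (fun a c => p (a, c)) (i 0).
exists (fun s => p (i (size s), code s)) => s t /pI[/iI].
elim: s t => [|a s IHs] [|b t] //= [/IHs {}IHs].
by move=> /pI[-> /IHs ->].
Qed.

End Square.

(** * Restricted direct sums of groups *)

Local Open Scope group_scope.

Section RestrictedSum.
Variables (I : eqType) (F : I -> groupType).

Record dsum := DSum {
  dsum_fun :> forall i, F i;
  dsum_supp : exists s : seq I, forall i, i \notin s -> dsum_fun i = 1 }.

HB.instance Definition _ := gen_eqMixin dsum.
HB.instance Definition _ := gen_choiceMixin dsum.

Implicit Types f g : dsum.

Lemma dsumP f g : (forall i, f i = g i) -> f = g.
Proof.
case: f g => [f Pf] [g Pg] /= fg.
have {}fg : f = g by exact: functional_extensionality_dep.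
by subst g; congr DSum; exact: Prop_irrelevance.
Qed.

Fact dsum_one_supp : exists s : seq I, forall i, i \notin s -> (1 : F i) = 1.
Proof. by exists nil. Qed.
Definition dsum_one := DSum dsum_one_supp.

Fact dsum_mul_supp f g :
  exists s : seq I, forall i, i \notin s -> f i * g i = 1.
Proof.
have [[s fs] [t gt]] := (dsum_supp f, dsum_supp g); exists (s ++ t) => i.
by rewrite mem_cat negb_or => /andP[/fs -> /gt ->]; rewrite mulg1.
Qed.
Definition dsum_mul f g := DSum (dsum_mul_supp f g).

Fact dsum_inv_supp f : exists s : seq I, forall i, i \notin s -> (f i)^-1 = 1.
Proof. by have [s fs] := dsum_supp f; exists s => i /fs ->; rewrite invg1. Qed.
Definition dsum_inv f := DSum (dsum_inv_supp f).

Fact single_supp i (x : F i) :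
  exists s : seq I, forall j, j \notin s -> dfwith (fun k => 1 : F k) x j = 1.
Proof.
by exists [:: i] => j; rewrite inE eq_sym => ij; rewrite dfwith_out.
Qed.
Definition single i (x : F i) := DSum (single_supp x).
Arguments single : clear implicits.

Fact dsum_mulA : associative dsum_mul.
Proof. by move=> f g h; apply: dsumP => i /=; rewrite mulgA. Qed.
Fact dsum_mul1 : left_id dsum_one dsum_mul.
Proof. by move=> f; apply: dsumP => i /=; rewrite mul1g. Qed.
Fact dsum_mul1r : right_id dsum_one dsum_mul.
Proof. by move=> f; apply: dsumP => i /=; rewrite mulg1. Qed.
Fact dsum_mulV : left_inverse dsum_one dsum_inv dsum_mul.
Proof. by move=> f; apply: dsumP => i /=; rewrite mulVg. Qed.
Fact dsum_mulVr : right_inverse dsum_one dsum_inv dsum_mul.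
Proof. by move=> f; apply: dsumP => i /=; rewrite mulgV. Qed.

HB.instance Definition _ := isGroup.Build dsum
  dsum_mulA dsum_mul1 dsum_mul1r dsum_mulV dsum_mulVr.

Lemma dsumME f g i : (f * g) i = f i * g i. Proof. by []. Qed.
Lemma dsumVE f i : f^-1 i = (f i)^-1. Proof. by []. Qed.
Lemma dsumXE f n i : (f ^+ n) i = f i ^+ n.
Proof. by elim: n => // n IHn; rewrite !expgS dsumME IHn. Qed.

Lemma single_in i (x : F i) : single i x i = x.
Proof. exact: dfwith_in. Qed.

Lemma single_out i (x : F i) j : i != j -> single i x j = 1.
Proof. exact: dfwith_out. Qed.

Lemma singleM i : {morph single i : x y / x * y}.
Proof.
move=> x y; apply: dsumP => j; rewrite dsumME.
have [<-|ij] := eqVneq i j; first by rewrite !single_in.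
by rewrite !single_out // mulg1.
Qed.

Lemma single_inj i : injective (single i).
Proof. by move=> x y xy; rewrite -[x]single_in xy single_in. Qed.

Lemma single_commute i j (x : F i) (y : F j) :
  i != j -> commute (single i x) (single j y).
Proof.
move=> ij; apply: dsumP => k; rewrite !dsumME.
have [ik|ik] := eqVneq i k; last by rewrite single_out // mulg1 mul1g.
by rewrite (@single_out j y) ?mulg1 ?mul1g // -ik eq_sym.
Qed.

Lemma dsum_ind (P : dsum -> Prop) : P 1 ->
  (forall i (x : F i), P (single i x)) ->
  (forall f g, P f -> P g -> P (f * g)) -> forall f, P f.
Proof.
move=> P1 Ps PM f; have [s] := dsum_supp f; elim: s f => [|i s IHs] f fs.
  suff -> : f = 1 by [].
  by apply: dsumP => i; rewrite fs.
rewrite -(mulVKg (single i (f i)) f); apply: PM => //; apply: IHs => j js.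
rewrite dsumME dsumVE; have [<-|ij] := eqVneq i j.
  by rewrite single_in mulVg.
by rewrite single_out // invg1 mul1g fs // inE eq_sym negb_or ij.
Qed.

(** The support being finite, exponents of the single coordinates multiply up to
    one common exponent; [S] is a multiplicative condition, such as not being
    divisible by a given prime, which that exponent inherits, and [J] selects
    the coordinates to be killed. *)
Lemma dsum_exponent f (S : {pred nat}) (J : {pred I}) :
  1%N \in S -> {in S &, forall m n, (m * n)%N \in S} ->
  (forall i, i \in J -> exists2 n, n \in S & f i ^+ n = 1) ->
  exists2 n, n \in S & forall i, i \in J -> (f ^+ n) i = 1.
Proof.
move=> S1 SM fJ.
suff [n nS fn] : exists2 n, n \in S &
    forall i, i \in sval (cid (dsum_supp f)) -> i \in J -> f i ^+ n = 1.
  exists n => // i iJ; rewrite dsumXE; case: cid fn => /= s fs fn.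
  by have [/fn->//|/fs->] := boolP (i \in s); rewrite expg1n.
elim: (sval _) => [|i s [n nS fn]]; first by exists 1%N.
have [iJ|iJ] := boolP (i \in J); last first.
  by exists n => // j; rewrite inE => /predU1P[->|/fn//]; rewrite (negPf iJ).
have [m mS fm] := fJ i iJ; exists (m * n)%N; first exact: SM.
move=> j; rewrite inE => /predU1P[-> _|js jJ].
  by rewrite expgnA fm expg1n.
by rewrite mulnC expgnA fn // expg1n.
Qed.

Lemma dsum_torsion : (forall i, torsion_group (F i)) -> torsion_group dsum.
Proof.
move=> Ft f; have [||i _|n n0 fn] := @dsum_exponent f [pred n | 0 < n] predT.
- by [].
- by move=> m n; rewrite !inE muln_gt0 => -> ->.
- by have [n] := Ft i (f i); exists n.
- by exists n => //; apply: dsumP => i; rewrite fn.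
Qed.

(** An element is recovered from the finite word of its pairs of index and value
    along a support. *)
Lemma dsum_embeds (A : Type) : infinite_set [set: A] ->
  embeds I A -> (forall i, embeds (F i) A) -> embeds dsum A.
Proof.
move=> Ainf [e eI] FA; apply: embeds_trans (infinite_seq Ainf).
have [p pI] := infinite_square Ainf.
pose c f i := p (e i, sval (cid (FA i)) (f i)).
have cI f g s t : [seq c f i | i <- s] = [seq c g i | i <- t] ->
    s = t /\ forall i, i \in s -> f i = g i.
  elim: s t => [|i s IHs] [|j t] //= [/pI[/eI <-] /(svalP (cid (FA i))) fgi].
  by move=> /IHs[<- fg]; split=> // k; rewrite inE => /predU1P[->|/fg].
exists (fun f => [seq c f i | i <- sval (cid (dsum_supp f))]) => f g.
case: cid => s fs; case: cid => /= t gt /cI[st fg]; apply: dsumP => i.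
by have [/fg//|nis] := boolP (i \in s); rewrite fs // gt -?st.
Qed.


End RestrictedSum.
Arguments single {I F} i x.

(** * Restricted wreath products *)

Section Wreath.
Variables L Q : groupType.
Local Notation base := (dsum (fun _ : Q => L)).

Record wreath := Wreath { lamps : base; top : Q }.

HB.instance Definition _ := gen_eqMixin wreath.
HB.instance Definition _ := gen_choiceMixin wreath.

Implicit Types (g h : wreath) (q s t : Q) (k l : L) (b : base).

Lemma wreathP g h : (forall t, lamps g t = lamps h t) -> top g = top h -> g = h.
Proof. by case: g h => [b q] [c r] /= /dsumP -> ->. Qed.

Fact shift_supp q b :
  exists s : seq Q, forall t, t \notin s -> b (q^-1 * t) = 1.
Proof.
have [s bs] := dsum_supp b; exists [seq q * t | t <- s] => t ts; apply: bs.
by apply: contra ts => /(map_f (fun t => q * t)); rewrite mulVKg.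
Qed.
Definition shift q b : base := DSum (shift_supp q b).

Definition wreath_one := Wreath 1 1.
Definition wreath_mul g h :=
  Wreath (lamps g * shift (top g) (lamps h)) (top g * top h).
Definition wreath_inv g := Wreath (shift (top g)^-1 (lamps g)^-1) (top g)^-1.

Fact wreath_mulA : associative wreath_mul.
Proof.
move=> f g h; apply: wreathP => [t|] /=; last by rewrite mulgA.
by rewrite (@mulgA L) invgM mulgA.
Qed.
Fact wreath_mul1 : left_id wreath_one wreath_mul.
Proof.
move=> h; apply: wreathP => [t|] /=; last by rewrite mul1g.
by rewrite invg1 !mul1g.
Qed.
Fact wreath_mul1r : right_id wreath_one wreath_mul.
Proof.
move=> h; apply: wreathP => [t|] /=; last by rewrite mulg1.
by rewrite mulg1.
Qed.
Fact wreath_mulV : left_inverse wreath_one wreath_inv wreath_mul.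
Proof.
move=> h; apply: wreathP => [t|] /=; last by rewrite mulVg.
by rewrite mulVg.
Qed.
Fact wreath_mulVr : right_inverse wreath_one wreath_inv wreath_mul.
Proof.
move=> h; apply: wreathP => [t|] /=; last by rewrite mulgV.
by rewrite invgK mulVKg mulgV.
Qed.

HB.instance Definition _ := isGroup.Build wreath
  wreath_mulA wreath_mul1 wreath_mul1r wreath_mulV wreath_mulVr.

Lemma lampsM g h t : lamps (g * h) t = lamps g t * lamps h ((top g)^-1 * t).
Proof. by []. Qed.
Lemma topM : {morph top : g h / g * h}. Proof. by []. Qed.
Lemma topV : {morph top : g / g^-1}. Proof. by []. Qed.
Lemma topX n : {morph top : g / g ^+ n}.
Proof. by move=> g; elim: n => // n IHn; rewrite !expgS topM IHn. Qed.

Definition of_base b : wreath := Wreath b 1.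
Definition lamp s k : wreath := of_base (single s k).
Definition of_top q : wreath := Wreath 1 q.

Lemma of_baseM : {morph of_base : b c / b * c}.
Proof.
move=> b c; apply: wreathP => [t|] /=; last by rewrite mulg1.
by rewrite invg1 mul1g.
Qed.
Lemma of_baseX n : {morph of_base : b / b ^+ n}.
Proof. by move=> b; elim: n => // n IHn; rewrite !expgS of_baseM IHn. Qed.
Lemma top_of_top q : top (of_top q) = q. Proof. by []. Qed.
Lemma lampsE s k : lamps (lamp s k) = single s k. Proof. by []. Qed.
Lemma top_lamp s k : top (lamp s k) = 1. Proof. by []. Qed.

Lemma lampM s : {morph lamp s : k l / k * l}.
Proof. by move=> k l; rewrite /lamp singleM of_baseM. Qed.

Lemma lampV s : {morph lamp s : k / k^-1}.
Proof.
move=> k; apply/esym/mulg1_eq; rewrite -lampM mulgV.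
apply: wreathP => // t; rewrite lampsE.
by have [<-|st] := eqVneq s t; rewrite ?single_in ?single_out.
Qed.

Lemma lamp_inj s : injective (lamp s).
Proof.
by move=> k l /(congr1 (fun h => lamps h s)); rewrite !lampsE !single_in.
Qed.

Lemma lamp_commute s t k l : s != t -> commute (lamp s k) (lamp t l).
Proof.
by move=> st; rewrite /commute -!of_baseM; congr of_base; apply: single_commute.
Qed.

Lemma base_ind (P : wreath -> Prop) : P 1 -> (forall s k, P (lamp s k)) ->
  (forall g h, P g -> P h -> P (g * h)) -> forall h, top h = 1 -> P h.
Proof.
move=> P1 Pl PM [b q] /= ->; elim/dsum_ind: b => // b c Pb Pc.
by rewrite -[Wreath _ 1]/(of_base (b * c)) of_baseM; apply: PM.
Qed.

Lemma wreath_torsion :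
  torsion_group L -> torsion_group Q -> torsion_group wreath.
Proof.
move=> Lt Qt h; have [n n0 hn] := Qt (top h).
have [m m0 bm] := dsum_torsion (fun=> Lt) (lamps (h ^+ n)).
exists (n * m)%N; first by rewrite muln_gt0 n0.
have -> : h ^+ (n * m) = of_base (lamps (h ^+ n)) ^+ m.
  by rewrite expgnA; congr (_ ^+ m); apply: wreathP => //; rewrite topX.
by rewrite -of_baseX bm.
Qed.

(** Conjugation by [h] carries the lamp group at [s] onto the lamp group at
    [top h * s]; both commutation lemmas below rest on this. *)
Lemma mul_lamp h s k :
  h * lamp s k = lamp (top h * s) (k ^ (lamps h (top h * s))^-1) * h.
Proof.
apply: wreathP => [t|]; last by rewrite !topM mulg1 mul1g.
rewrite !lampsM !lampsE top_lamp invg1 mul1g.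
have [<-|st] := eqVneq (top h * s) t.
  by rewrite mulKg !single_in conjgE invgK !mulgA mulgVK.
rewrite !single_out // ?mulg1 ?mul1g //.
by apply: contra st => /eqP ->; rewrite mulVKg.
Qed.

(** A conjugate of a lamp by an element outside the base lives at another
    position. *)
Lemma lamp_conj_commute h s k :
  top h != 1 -> commute (lamp s k) (h * lamp s k * h^-1).
Proof.
move=> h1; rewrite mul_lamp mulgK; apply: lamp_commute.
by rewrite eq_sym -[X in _ != X]mul1g (inj_eq (mulIg s)).
Qed.

(** This separates elements outside the base from lamps, in view of
    [lamp_conj_commute]. With [q] the top of [h], dividing the conjugate by [h]
    leaves the lamp [k] at [s] times the inverse of a conjugate [k'] of [k] at
    [q * s]. If [h] commuted with that, comparing the coordinates at [q * s]
    would give [k' = k'^-1]. *)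
Lemma conj_lamp_noncommute h s k : top h != 1 -> k * k != 1 ->
  ~ commute h (lamp s k * h * (lamp s k)^-1).
Proof.
move=> h1 /eqP k2; set q := top h in h1; set k' := k ^ (lamps h (q * s))^-1.
have -> : lamp s k * h * (lamp s k)^-1 = lamp s k * lamp (q * s) k'^-1 * h.
  by rewrite -lampV -!mulgA mul_lamp conjVg.
rewrite /commute !mulgA => /mulIg.
rewrite (mul_lamp h) -(mulgA _ h) (mul_lamp h) mulgA => /mulIg.
move=> /(congr1 (fun g => lamps g (q * s))).
rewrite !lampsM !lampsE !top_lamp !invg1 !mul1g !single_in.
have qr r : r != q * r by rewrite -[X in X != _]mul1g (inj_eq (mulIg r)) eq_sym.
rewrite !single_out -/q // 1?eq_sym // (@mulg1 L) (@mul1g L) -/k' => kV.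
apply: k2; apply: (conjg_inj (lamps h (q * s))^-1).
by rewrite conjMg conj1g -/k' {1}kV mulVg.
Qed.

End Wreath.

(** * Automorphisms and the base group *)

Section Multiplicative.
Variables (G H : groupType) (f : {multiplicative G -> H}).

Lemma multiplicative1 : f 1 = 1.
Proof. by apply: (mulgI (f 1)); rewrite -gmulfM !mulg1. Qed.

Lemma multiplicativeV : {morph f : x / x^-1}.
Proof.
by move=> x; apply/esym/mulg1_eq; rewrite -gmulfM mulgV multiplicative1.
Qed.

Lemma multiplicativeX n : {morph f : x / x ^+ n}.
Proof.
move=> x; elim: n => [|n IHn]; first exact: multiplicative1.
by rewrite !expgS gmulfM IHn.
Qed.

End Multiplicative.

Lemma multiplicative_inverse (G : groupType) (phi : {multiplicative G -> G}) :
  bijective phi ->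
  exists psi : {multiplicative G -> G}, cancel phi psi /\ cancel psi phi.
Proof.
move=> [psi phiK psiK].
have psiM : {morph psi : x y / x * y} by exact: can2_gmulfM phiK psiK.
pose psi' : {multiplicative G -> G} :=
  HB.pack psi (isMultiplicative.Build G G psi psiM).
by exists psi'.
Qed.

Section BaseComparable.
Variables L Q : groupType.
Local Notation H := (wreath L Q).

Definition preserves_base (f : H -> H) := forall h, top h = 1 -> top (f h) = 1.

Lemma preserves_base_lamps (f : {multiplicative H -> H}) :
  (forall s k, top (f (lamp s k)) = 1) -> preserves_base f.
Proof.
move=> fl; apply: (base_ind (P := fun h => top (f h) = 1)) => [|//|g h].
  by rewrite multiplicative1.
by rewrite gmulfM topM => -> ->; rewrite mulg1.
Qed.

(** If [phi] moves some lamp [x] out of the base, then [phi x] does not commute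
    with its conjugate by any lamp [y] with [y * y != 1]. Hence [x] does not
    commute with its conjugate by [psi y], which forces [psi y] into the base
    because [x] commutes with its conjugates by elements outside. Such [y]
    generate the base. *)
Lemma preserves_base_or (phi psi : {multiplicative H -> H}) :
  (forall k : L, exists l m, [/\ k = l * m, l * l != 1 & m * m != 1]) ->
  cancel phi psi -> cancel psi phi -> preserves_base phi \/ preserves_base psi.
Proof.
move=> Lgen phiK psiK.
have [?|/existsNP[s /existsNP[k /eqP sk1]]] :=
  pselect (forall s k, top (phi (lamp s k)) = 1).
  by left; apply: preserves_base_lamps.
right; apply: preserves_base_lamps => t l'.
suff B l : l * l != 1 -> top (psi (lamp t l)) = 1.
  have [l [m [-> /B l1 /B m1]]] := Lgen l'.
  by rewrite lampM gmulfM topM l1 m1 mulg1.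
move=> l2; apply/eqP; apply: contra_notT (conj_lamp_noncommute (s := t) sk1 l2).
move=> tl1; rewrite /commute -(psiK (lamp t l)).
by rewrite -multiplicativeV -!gmulfM (lamp_conj_commute s k tl1).
Qed.

End BaseComparable.

(** * Dihedral groups of odd prime degree *)

Section Dihedral.
Local Open Scope ring_scope.
Variable p : nat.

(** For an odd prime [p], the affine maps [z |-> angle + (-1) ^ flip * z] of the
    field with [p] elements under composition. *)
Record dihedral := Dihedral { angle : 'F_p; flip : bool }.

HB.instance Definition _ := gen_eqMixin dihedral.
HB.instance Definition _ := gen_choiceMixin dihedral.

Definition dihedral_one := Dihedral 0 false.
Definition dihedral_mul x y :=
  Dihedral (angle x + (-1) ^+ flip x * angle y) (flip x (+) flip y).
Definition dihedral_inv x := Dihedral (- (-1) ^+ flip x * angle x) (flip x).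

Fact dihedral_mulA : associative dihedral_mul.
Proof.
move=> [a x] [b y] [c z]; rewrite /dihedral_mul /= addbA.
by congr Dihedral; case: x y => -[] /=; ring.
Qed.
Fact dihedral_mul1 : left_id dihedral_one dihedral_mul.
Proof. by move=> [a x]; rewrite /dihedral_mul /= mul1r add0r. Qed.
Fact dihedral_mul1r : right_id dihedral_one dihedral_mul.
Proof. by move=> [a x]; rewrite /dihedral_mul /= mulr0 addr0 addbF. Qed.
Fact dihedral_mulV : left_inverse dihedral_one dihedral_inv dihedral_mul.
Proof.
move=> [a x]; rewrite /dihedral_mul /= addbb; congr Dihedral.
by case: x => /=; ring.
Qed.
Fact dihedral_mulVr : right_inverse dihedral_one dihedral_inv dihedral_mul.
Proof.
move=> [a x]; rewrite /dihedral_mul /= addbb; congr Dihedral.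
by case: x => /=; ring.
Qed.
HB.instance Definition _ := isGroup.Build dihedral dihedral_mulA
  dihedral_mul1 dihedral_mul1r dihedral_mulV dihedral_mulVr.

Definition rotation (a : 'F_p) : dihedral := Dihedral a false.

Lemma flip_mul : {morph flip : x y / (x * y)%g >-> x (+) y}.
Proof. by []. Qed.

Lemma rotationX a n : (rotation a ^+ n)%g = rotation (a *+ n).
Proof.
elim: n => // n IHn; rewrite expgS IHn mulrS.
by congr Dihedral; rewrite /= mul1r.
Qed.

Lemma rotationV a : ((rotation a)^-1)%g = rotation (- a).
Proof. by congr Dihedral; rewrite /= mulN1r. Qed.

Lemma dihedral_square x : exists a, (x ^+ 2)%g = rotation a.
Proof.
by exists (angle (x * x)%g); rewrite expg2; congr Dihedral; rewrite /= addbb.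
Qed.

Lemma mul_rotation x a :
  (x * rotation a)%g = (rotation ((-1) ^+ flip x * a)%R * x)%g.
Proof. by congr Dihedral; rewrite /= ?addbF // mul1r addrC. Qed.

Lemma Fp_natr_eq0 n : prime p -> ((n%:R : 'F_p) == 0) = (p %| n)%N.
Proof. by move=> p_pr; rewrite -(dvdn_pcharf (pchar_Fp p_pr)). Qed.

Lemma rotationXp a : prime p -> (rotation a ^+ p)%g = 1%g.
Proof.
move=> p_pr; have /eqP p0 : (p%:R : 'F_p) == 0 by rewrite Fp_natr_eq0.
by rewrite rotationX -mulr_natr p0 mulr0.
Qed.

Lemma dihedral_torsion : prime p -> torsion_group dihedral.
Proof.
move=> p_pr x; exists (2 * p)%N; first by rewrite muln_gt0 /= prime_gt0.
by have [a xa] := dihedral_square x; rewrite expgnA xa rotationXp.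
Qed.

Lemma dihedral_embeds_nat : embeds dihedral nat.
Proof.
exists (fun x => pickle (angle x, flip x)) => -[a x] [b y].
by move=> /(pcan_inj pickleK)[-> ->].
Qed.

End Dihedral.

(** * Signs are invariant under automorphisms *)

(** A homomorphism to a group of order two that is invariant under [phi] takes
    the same value on [x] and on [phi z^-1 * x * z], so it is constant on
    twisted classes. *)
Lemma infinite_twisted_classes (H : groupType) (I : choiceType)
    (chi : I -> H -> bool) (a : I -> H) (phi : {multiplicative H -> H}) :
  infinite_set [set: I] ->
  (forall i, {morph chi i : x y / x * y >-> x (+) y}) ->
  (forall i x, chi i (phi x) = chi i x) ->
  (forall i j, chi i (a j) = (i == j)) ->
  infinite_set (twisted_classes phi).
Proof.
move=> Iinf chiM chi_phi chia.
have chi1 i : chi i 1 = false.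
  by have := chiM i 1 1; rewrite mulg1; case: (chi i 1).
have chi_class i x y : twisted_conjugate phi x y -> chi i x = chi i y.
  move=> [z <-]; rewrite !chiM chi_phi -addbA addbC -addbA -chiM mulgV.
  by rewrite chi1 addbF.
have aI : injective (fun i => twisted_class phi (a i)).
  move=> i j ij; have : twisted_class phi (a i) (a i).
    by exists 1; rewrite invg1 multiplicative1 mul1g mulg1.
  by rewrite ij => /(chi_class i); rewrite !chia eqxx => /eqP.
apply: (@sub_infinite_set _ [set twisted_class phi (a i) | i in [set: I]]).
  by move=> _ [i _ <-]; exists (a i).
by rewrite (eq_finite_set (inj_card_eq (in2W aI))).
Qed.

Definition odd_prime := {p : nat | prime p && odd p}.

Lemma odd_prime_infinite : infinite_set [set: odd_prime].
Proof.
move=> /finite_seqP[s sE].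
have [p p_gt p_pr] := prime_above (maxn 2 (\max_(q <- s) val q)).
have [p2 ps] : (2 < p)%N /\ (\max_(q <- s) val q < p)%N.
  by apply/andP; rewrite -gtn_max.
have pP : prime p && odd p by rewrite p_pr; case: (even_prime p_pr) p2 => // ->.
pose q : odd_prime := Sub p pP.
have /= qs : q \in s by have : [set` s] q by rewrite -sE.
have := @leq_bigmax_seq _ s xpredT (fun x => val x) q qs isT.
by rewrite leqNgt ps.
Qed.

Section Signs.
Variable L : groupType.
Definition dihedrals := dsum (fun p : odd_prime => dihedral (val p)).
Local Notation H := (wreath L dihedrals).

Definition sign (p : odd_prime) (h : H) : bool := flip (top h p).

(** The endomorphism [fbar] induced by [f] on the sum of the dihedral groups is
    onto. A preimage of a [p]-rotation, raised to a suitable power prime to [p],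
    has only a [p]-rotation left as top; so [fbar] sends some [p]-rotation to a
    nontrivial [p]-rotation. The sign of [h] tells whether conjugation by [h]
    fixes or inverts [p]-rotations, and these two are distinguished by the
    action on a single nontrivial rotation. *)
Lemma sign_preserved (f : {multiplicative H -> H}) :
  (forall h, exists g, f g = h) -> preserves_base f ->
  forall p h, sign p (f h) = sign p h.
Proof.
move=> f_onto fB p h.
have p_pr : prime (val p) by case/andP: (valP p).
have [u fu] := f_onto (of_top L (single p (rotation 1%R))).
(* Squares are rotations, and a q-rotation has order dividing q, which is
   prime to p for q != p; hence the exponent n is prime to p. *)
have [||q qp|n np un] := @dsum_exponent _ _ (top u ^+ 2)
    [pred n | ~~ (val p %| n)%N] (predC1 p).
- by rewrite inE dvdn1; case: eqP p_pr => // ->.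
- by move=> m n; rewrite !inE Euclid_dvdM // negb_or => -> ->.
- have q_pr : prime (val q) by case/andP: (valP q).
  exists (val q); first by rewrite inE dvdn_prime2 // eq_sym val_eqE.
  have [a ua] := dihedral_square (top u q).
  by rewrite dsumXE ua rotationXp.
set w := (u ^+ 2) ^+ n.
have [a wa] : exists a, top w = single p (rotation a).
  have [a ua] := dihedral_square (top u p); exists (a *+ n)%R.
  apply: dsumP => q; rewrite /w !topX.
  have [<-|pq] := eqVneq p q; last first.
    by rewrite single_out // un // inE eq_sym.
  by rewrite single_in !dsumXE ua rotationX.
have p_odd : odd (val p) by case/andP: (valP p).
(* At p, the top of f w is the rotation by 2 n, and p does not divide 2 n. *)
set m : 'F_(val p) := (1 *+ 2 *+ n)%R.
have fw : top (f w) p = rotation m.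
  rewrite /w !multiplicativeX fu !topX !dsumXE.
  by rewrite top_of_top single_in (rotationX _ 2) rotationX.
have two0 : (2%:R != 0 :> 'F_(val p))%R.
  by rewrite Fp_natr_eq0 // dvdn_prime2 //; apply: contraL p_odd => /eqP ->.
have m0 : (m != 0)%R.
  by rewrite /m -[(_ *+ n)%R]mulr_natr mulf_neq0 // Fp_natr_eq0.
(* Up to the base, w' is the conjugate of w by h, and f keeps the base. *)
pose w' := if sign p h then w^-1 else w.
have hw : top (h * w) = top (w' * h).
  apply: dsumP => q; rewrite !topM !dsumME /w'.
  have [<-|pq] := eqVneq p q; last first.
    have w1 : top w q = 1 by rewrite wa single_out.
    by case: ifP => _; rewrite ?topV ?dsumVE w1 ?invg1 mulg1 mul1g.
  have wp : top w p = rotation a by rewrite wa single_in.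
  rewrite wp mul_rotation /sign; case: ifP => _; rewrite ?topV ?dsumVE wp.
    by rewrite mulN1r rotationV.
  by rewrite mul1r.
have /fB : top (h * w * (w' * h)^-1) = 1 by rewrite topM topV hw mulgV.
rewrite gmulfM multiplicativeV topM topV => /divg1_eq.
rewrite !gmulfM !topM => /(congr1 (fun x : dihedrals => x p)).
rewrite !dsumME fw mul_rotation => /mulIg.
have -> : top (f w') p = rotation ((-1) ^+ sign p h * m)%R.
  rewrite /w'; case: ifP => _; last by rewrite fw mul1r.
  by rewrite multiplicativeV topV dsumVE fw rotationV mulN1r.
rewrite -/(sign p (f h)) => /(congr1 (@angle _)).
rewrite ![angle _]/= => /(mulIf m0).
have N1 : (-1 != 1 :> 'F_(val p))%R.
  by rewrite -subr_eq0 -opprD oppr_eq0.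
case: (sign p (f h)) (sign p h) => -[] // /eqP; first by rewrite (negPf N1).
by rewrite eq_sym (negPf N1).
Qed.

End Signs.

Lemma dihedrals_torsion : torsion_group dihedrals.
Proof.
by apply: dsum_torsion => p; apply: dihedral_torsion; case/andP: (valP p).
Qed.

Lemma dihedrals_embeds (A : Type) : infinite_set [set: A] -> embeds dihedrals A.
Proof.
move=> Ainf; apply: dsum_embeds => // [|p].
  apply: embeds_trans (infinite_embeds_nat Ainf).
  by exists val; apply: val_inj.
exact: embeds_trans (dihedral_embeds_nat _) (infinite_embeds_nat Ainf).
Qed.

Lemma contains_copy_inj (G H : groupType) (f : {multiplicative G -> H}) :
  injective f -> contains_copy H G.
Proof.
move=> fI; exists (fun h => `[< exists g, f g = h >]).
  split; first by apply/asboolP; exists 1; apply: multiplicative1.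
  move=> _ _ /asboolP[x <-] /asboolP[y <-]; apply/asboolP; exists (x / y).
  by rewrite gmulfM multiplicativeV.
exists f; split=> [g _|x y _ _ /fI //|h].
  by apply/asboolP; exists g.
by move=> /asboolP[g <-]; exists g.
Qed.

(** Invariance of the signs under the inverse of [phi] is as good as invariance
    under [phi], so it does not matter which of the two preserves the base. *)
Lemma wreath_R_infinity (L : groupType) :
  (forall k : L, exists l m, [/\ k = l * m, l * l != 1 & m * m != 1]) ->
  R_infinity (wreath L dihedrals).
Proof.
move=> Lgen phi /multiplicative_inverse[psi [phiK psiK]].
apply: (@infinite_twisted_classes _ _ (@sign L)
  (fun p => of_top L (single p (Dihedral 0%R true)))).
- exact: odd_prime_infinite.
- by move=> p g h; rewrite /sign topM dsumME flip_mul.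
- move=> p h; have [phiB|psiB] := preserves_base_or Lgen phiK psiK.
    by apply: sign_preserved => // g; exists (psi g); apply: psiK.
  transitivity (sign p (psi (phi h))); last by rewrite phiK.
  by apply/esym/sign_preserved => // g; exists (phi g); apply: phiK.
- move=> p q; rewrite /sign top_of_top.
  have [<-|pq] := eqVneq q p; first by rewrite single_in.
  by rewrite single_out.
Qed.

Lemma wreath_embeds (L Q : groupType) (A : Type) : infinite_set [set: A] ->
  embeds L A -> embeds Q A -> embeds (wreath L Q) A.
Proof.
move=> Ainf LA QA; have baseA := dsum_embeds Ainf QA (fun=> LA).
apply: embeds_trans (infinite_square Ainf).
apply: embeds_trans (embeds_prod baseA QA).
by exists (fun h => (lamps h, top h)) => -[b q] [c r] [-> ->].
Qed.

(** * Lamp groups of prescribed cardinality *)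

Section Padding.
Variables (G : groupType) (A : Type).

(** The summands [dihedral 3] raise the cardinality of [G] to that of [A] and
    provide elements whose square is not trivial. *)
Definition padding (o : option {classic A}) : groupType :=
  if o is Some _ then dihedral 3 else G.
Definition padded := dsum padding.

Lemma padded_torsion : torsion_group G -> torsion_group padded.
Proof.
by move=> Gt; apply: dsum_torsion => -[a|] //; apply: dihedral_torsion.
Qed.

(** Multiply [k] by a rotation of order three in a summand where [k] is
    trivial. *)
Lemma padded_square_gen : infinite_set [set: A] -> forall k : padded,
  exists l m, [/\ k = l * m, l * l != 1 & m * m != 1].
Proof.
move=> Ainf k.
have [a ka] : exists a : {classic A}, k (Some a) = 1.
  have [s ks] := dsum_supp k; apply: contrapT => /forallNP kA; apply: Ainf.
  apply: (@sub_finite_set _ _ [set a | a \in (pmap id s : seq {classic A})]).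
    move=> a _; rewrite /= -(mem_map (@Some_inj _)) pmapS_filter map_id.
    rewrite mem_filter /=; apply: contraT => as_; case: (kA a); exact: ks.
  by apply/finite_seqP; exists (pmap id s).
pose z : padded :=
  single (Some a : option {classic A}) (rotation 1%R : dihedral 3).
have za : z (Some a) = rotation 1%R by rewrite /z single_in.
exists (k * z), z^-1; rewrite mulgK; split=> //; apply/eqP.
  move=> /(congr1 (fun f : padded => f (Some a))); rewrite !dsumME ka za mul1g.
  by move=> /(congr1 (@angle 3)).
move=> /(congr1 (fun f : padded => f (Some a))); rewrite dsumME dsumVE za.
by move=> /(congr1 (@angle 3)).
Qed.

Lemma padded_embeds : infinite_set [set: A] -> embeds G A -> embeds padded A.
Proof.
move=> Ainf GA; apply: dsum_embeds => // [|[a|//]].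
  have [p pI] := infinite_square Ainf.
  have [i iI] := infinite_embeds_nat Ainf.
  exists (fun o : option {classic A} =>
    if o is Some a then p (i 0%N, a) else p (i 1%N, i 1%N)).
  by move=> [a|] [b|] //= /pI[] => [->|/iI|/iI].
exact: embeds_trans (dihedral_embeds_nat _) (infinite_embeds_nat Ainf).
Qed.

Lemma embeds_padded : embeds A padded.
Proof.
pose z (a : {classic A}) : padded :=
  single (Some a) (rotation 1%R : dihedral 3).
exists z => a b /(congr1 (fun f : padded => f (Some a))).
rewrite /z single_in.
have [[<-] //|ba] := eqVneq (Some b : option {classic A}) (Some a).
by rewrite single_out // => /(congr1 (@angle 3)).
Qed.

End Padding.

(* The cardinal alpha is that of the type A. *)
Theorem corollary3p10 (G : groupType) (A : Type) :
  torsion_group G ->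
  infinite_set [set: A] ->
  [set: G] #<= [set: A] ->
  exists H : groupType,
    [/\ torsion_group H, [set: H] #= [set: A], R_infinity H & contains_copy H G].
Proof.
move=> Gt Ainf /card_le_embeds GA; pose L := padded G A.
exists (wreath L dihedrals); split.
- exact: wreath_torsion (padded_torsion Gt) dihedrals_torsion.
- apply: Cantor_Bernstein; apply/card_le_embeds.
    exact: wreath_embeds (padded_embeds Ainf GA) (dihedrals_embeds Ainf).
  apply: embeds_trans (embeds_padded G A) _.
  by exists (lamp 1); apply: lamp_inj.
- exact/wreath_R_infinity/padded_square_gen.
- pose f (g : G) : wreath L dihedrals :=
    lamp 1 (single (None : option {classic A}) (g : padding G None)).
  have fM : {morph f : x y / x * y}.
    by move=> x y; rewrite /f (@singleM _ (@padding G A)) lampM.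
  pose f' : {multiplicative G -> wreath L dihedrals} :=
    HB.pack f (isMultiplicative.Build G (wreath L dihedrals) f fM).
  apply: (contains_copy_inj (f := f')) => x y /lamp_inj.
  exact: single_inj.
Qed.
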